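(* Let $I=(f_1,\ldots,f_r)\subseteq\mathbb C[x_1,\ldots,x_n]$ be an ideal generated by homogeneous polynomials $f_1,\ldots,f_r$ of a common degree $d$. Suppose that for every $\alpha=(\alpha_1,\ldots,\alpha_r)\in\mathbb Z_{\ge 0}^r$ there is a homogeneous polynomial $P_\alpha\in\mathbb C[x_1,\ldots,x_n]$ of degree $d|\alpha|$ such that $P_0\neq 0$ and $$x_iP_\alpha=\sum_{k=1}^r(\partial_i f_k)(\partial)\,P_{\alpha+e_k}\qquad\text{for every } 1\le i\le n \text{ and every } \alpha\in\mathbb Z_{\ge 0}^r.$$ Then $b_I(-n/d)=0$, where $b_I(s)$ is the Bernstein-Sato polynomial of $I$.
   Context: Notation: $|\alpha|=\alpha_1+\cdots+\alpha_r$; $e_k\in\mathbb Z^r$ is the $k$-th standard basis vector; $\partial_i=\partial/\partial x_i$. For a polynomial $h(x_1,\ldots,x_n)$, $h(\partial)$ denotes the constant-coefficient differential operator obtained by replacing each $x_j$ by $\partial_j$; thus $(\partial_if_k)(\partial)$ is obtained in this way from the polynomial $\partial f_k/\partial x_i$. The zero polynomial counts as homogeneous of every degree. Bernstein-Sato polynomial of an ideal (Budur-Mustata-Saito): let $D_x$ be the Weyl algebra of $\mathbb C$-linear polynomial differential operators in $x_1,\ldots,x_n$. For a nonzero ideal $I\subseteq\mathbb C[x_1,\ldots,x_n]$ choose nonzero generators $f_1,\ldots,f_r$, let $s_1,\ldots,s_r$ be independent variables, and let $f_1^{s_1}\cdots f_r^{s_r}$ be the formal generator of the free rank-one module over $\mathbb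 C[x_1,\ldots,x_n][f_1^{-1},\ldots,f_r^{-1},s_1,\ldots,s_r]$, on which $D_x[s_1,\ldots,s_r]$ acts in the obvious way (by $\partial_i f_k^{s_k}=s_k(\partial_if_k)f_k^{-1}f_k^{s_k}$ and the Leibniz rule). Then $b_I(s)$ is the monic polynomial of smallest degree such that $$b_I(s_1+\cdots+s_r)f_1^{s_1}\cdots f_r^{s_r}\in\sum_{u\in\mathbb Z^r,\ u_1+\cdots+u_r=1}D_x[s_1,\ldots,s_r]\cdot\Big(\prod_{u_i<0}\tbinom{s_i}{-u_i}\Big)f_1^{s_1+u_1}\cdots f_r^{s_r+u_r},$$ where $\binom{s_i}{m}=s_i(s_i-1)\cdots(s_i-m+1)/m!$. It exists and is independent of the chosen generators. *)

(* Defs.v *)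
From HB Require Import structures.
From mathcomp Require Import all_boot all_order all_algebra.
From mathcomp Require Import fraction generic_quotient.
From mathcomp Require Import reals complex.
From mathcomp Require Import mpoly ring.

Set Implicit Arguments.
Unset Strict Implicit.
Unset Printing Implicit Defensive.

Import GRing.Theory.
Local Open Scope ring_scope.

Lemma frac_repr (R : idomainType) (a : {fraction R}) :
  a * FracField.tofrac (frac (repr a)).2 = FracField.tofrac (frac (repr a)).1.
Proof.
suff h (x : {ratio R}) :
    FracField.mul (\pi_({fraction R})%qT x) (FracField.tofrac (frac x).2) =
    FracField.tofrac (frac x).1.
  by have := h (repr a); rewrite reprK.
apply/eqP; rewrite !piE FracField.equivfE /FracField.mulf.
by rewrite !numden_Ratio ?mulf_neq0 ?oner_eq0 ?denom_ratioP // !mulr1 mulrC.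
Qed.

Lemma quotient_rule_aux (R : comNzRingType) (p q p' q' dp dq dp' dq' : R) :
  p * q' = p' * q -> dp * q' + p * dq' = dp' * q + p' * dq ->
  (dp * q - p * dq) * q' ^+ 2 = (dp' * q' - p' * dq') * q ^+ 2.
Proof.
move=> e eD.
have eDp : dp * q' = dp' * q + p' * dq - p * dq' by rewrite -eD addrK.
transitivity (q * q' * (dp * q') - q' * dq * (p * q')); first by ring.
transitivity (q * q' * (dp' * q + p' * dq) - q * dq' * (p * q')
              - q' * dq * (p * q')).
  by rewrite eDp; ring.
by rewrite e; ring.
Qed.

Section BernsteinSato.

Variables (K : fieldType) (n : nat).

Definition ideal_gen (r : nat) (f : 'I_r -> {mpoly K[n]}) :
    {mpoly K[n]} -> Prop :=
  fun p => exists a : 'I_r -> {mpoly K[n]}, p = \sum_(k < r) a k * f k.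

(* [diffop h p] is h(d/dx_1, ..., d/dx_n) applied to p. *)
Definition diffop (h p : {mpoly K[n]}) : {mpoly K[n]} :=
  \sum_(m <- msupp h) h@_m *: p^`M[m].

Notation ratfun := {fraction {mpoly K[n]}}.

Definition polyF (p : {mpoly K[n]}) : ratfun := FracField.tofrac p.

(* The partial derivative on K(x_1, ..., x_n), by the quotient rule applied to
   a representative; see [fderivE] for its independence of that choice. *)
Definition fderiv (i : 'I_n) (a : ratfun) : ratfun :=
  let p := (frac (repr a)).1 in
  let q := (frac (repr a)).2 in
  polyF (p^`M(i) * q - p * q^`M(i)) / polyF (q ^+ 2).

Lemma fderivE (i : 'I_n) (p q : {mpoly K[n]}) : q != 0 ->
  fderiv i (polyF p / polyF q) =
  polyF (p^`M(i) * q - p * q^`M(i)) / polyF (q ^+ 2).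
Proof.
move=> q0; rewrite /fderiv.
set a := (polyF p / polyF q); set p' := (frac (repr a)).1; set q' := (frac (repr a)).2.
have q'0 : q' != 0 by exact: denom_ratioP.
have F0 t : t != 0 -> polyF t != 0 by rewrite /polyF tofrac_eq0.
have aE : a = polyF p' / polyF q'.
  have h : a * polyF q' = polyF p' by exact: frac_repr.
  by rewrite -h mulfK ?F0.
have e : p * q' = p' * q.
  apply/eqP; rewrite -tofrac_eq !tofracM -!/(polyF _).
  by rewrite -eqr_div ?F0 // -aE.
have eD : p^`M(i) * q' + p * q'^`M(i) = p'^`M(i) * q + p' * q^`M(i).
  by rewrite -!mderivM e.
apply/eqP; rewrite eqr_div ?F0 ?expf_neq0 // /polyF -!tofracM tofrac_eq.
apply/eqP.
by exact: quotient_rule_aux.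
Qed.

Section Generators.

Variables (r : nat) (g : 'I_r -> {mpoly K[n]}).

(* An element a of [bsmod] stands for a g_1^{s_1} ... g_r^{s_r}; the variable
   'X_k is s_k.  The coefficient ring K[x][1/g_1, ..., 1/g_r, s_1, ..., s_r] is
   enlarged to K(x)[s_1, ..., s_r], which contains it as the g_k are nonzero;
   this does not change the D_x[s]-submodule generated by given elements. *)
Notation bsmod := {mpoly ratfun[r]}.

Definition bs_deriv (i : 'I_n) (a : bsmod) : bsmod :=
  map_mpoly (fderiv i) a
  + a * \sum_(k < r) (polyF (g k)^`M(i) / polyF (g k)) *: 'X_k.

(* The endomorphisms of [bsmod] given by the elements of D_x[s_1, ..., s_r]. *)
Inductive weyl_op : (bsmod -> bsmod) -> Prop :=
| weyl_poly (p : {mpoly K[n]}) : weyl_op (fun a => polyF p *: a)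
| weyl_s (k : 'I_r) : weyl_op (fun a => 'X_k * a)
| weyl_deriv (i : 'I_n) : weyl_op (bs_deriv i)
| weyl_add P Q : weyl_op P -> weyl_op Q -> weyl_op (fun a => P a + Q a)
| weyl_comp P Q : weyl_op P -> weyl_op Q -> weyl_op (fun a => P (Q a)).

Definition sbinom (k : 'I_r) (m : nat) : bsmod :=
  (m`!%:R)^-1 *: \prod_(j < m) ('X_k - j%:R).

(* (prod_{u_k < 0} binom(s_k, -u_k)) g_1^{s_1 + u_1} ... g_r^{s_r + u_r} *)
Definition bs_gen (u : {ffun 'I_r -> int}) : bsmod :=
  (\prod_(k < r) polyF (g k) ^ u k) *:
    \prod_(k < r | u k < 0) sbinom k `|u k|%N.

Definition bs_const (c : K) : bsmod := (polyF c%:MP)%:MP.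

(* b(s_1 + ... + s_r) g^s lies in the sum over u of the D_x[s] bs_gen u; the
   elements of that sum are the finite sums indexed by some list us. *)
Definition bs_relation (b : {poly K}) : Prop :=
  exists (us : seq {ffun 'I_r -> int})
         (Q : {ffun 'I_r -> int} -> bsmod -> bsmod),
  [/\ forall u, u \in us -> \sum_(k < r) u k = 1,
      forall u, u \in us -> weyl_op (Q u)
    & (map_poly bs_const b).[\sum_(k < r) 'X_k] =
        \sum_(u <- us) Q u (bs_gen u)].

Definition bs_minimal (b : {poly K}) : Prop :=
  [/\ b \is monic, bs_relation b
    & forall c : {poly K}, c \is monic -> bs_relation c ->
        (size b <= size c)%N].

End Generators.

Definition bernstein_sato (I : {mpoly K[n]} -> Prop) (b : {poly K}) : Prop :=
  (exists2 p, I p & p != 0) /\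
  exists (r : nat) (g : 'I_r -> {mpoly K[n]}),
  [/\ forall k, g k != 0,
      forall p, I p <-> ideal_gen g p
    & bs_minimal g b].

End BernsteinSato.

(* Main.v *)
(** Write s_j = - d/dt_j t_j, so that g^s becomes the delta function
    delta(t - g) on the graph of g, and B_g = K[x][d/dt] delta(t - g).  Pair
    polynomials by <h, p> = (h(d/dx) p)(0) and put
    lam (h (d/dt)^a delta(t - f)) = <h, P_a> on B_f.  The recursion for the
    P_a says that lam kills every d_i B_f; with Euler's formula it follows that
    lam o (s_1 + ... + s_r) = - n/d lam.  For degree reasons, lam kills
    h (d/dt)^a delta as soon as h has order > d |a|.

    The generators g computing b_I need not be the f_k.  Writing
    f_k = \sum_j c_kj g_j with polynomial c_kj, the substitution
    d/dt_j |-> \sum_k c_kj d/dt_k sends B_g to B_f and commutes with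
    s_1 + ... + s_r, but it commutes with d_i only up to the terms
    (d_i c_kj) d/dt_k t_j.  One therefore considers the elements of B_g that are
    killed by all the functionals lam (eta . t^J) with eta of degree <= |J| in
    d/dt: they form a D_x[s]-submodule which contains all the generators of the
    right-hand side of the functional equation.  Applying lam to that equation
    gives b(- n/d) P_0 = 0. *)

From HB Require Import structures.
Require Import Defs.
From mathcomp Require Import all_boot all_order all_algebra.
From mathcomp Require Import fraction reals complex.
From mathcomp Require Import ssrcomplements mpoly ring zify.

Set Implicit Arguments.
Unset Strict Implicit.
Unset Printing Implicit Defensive.

Import Order.TTheory GRing.Theory Num.Theory.
Local Open Scope ring_scope.

(** * Additive maps *)

Section ZmodMorphism.

Variables (U V : zmodType) (F : U -> V).
Hypothesis F_additive : zmod_morphism F.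

Lemma zmod_morphism0 : F 0 = 0.
Proof. by have := F_additive 0 0; rewrite !subrr. Qed.

Lemma zmod_morphismD x y : F (x + y) = F x + F y.
Proof.
have FN z : F (- z) = - F z by rewrite -[- z]sub0r F_additive zmod_morphism0 sub0r.
by rewrite -[y in LHS]opprK F_additive FN opprK.
Qed.

Lemma zmod_morphism_sum (I : Type) (s : seq I) (P : pred I) (E : I -> U) :
  F (\sum_(i <- s | P i) E i) = \sum_(i <- s | P i) F (E i).
Proof.
by elim/big_rec2: _ => [|i x y _ <-]; rewrite ?zmod_morphism0 ?zmod_morphismD.
Qed.

End ZmodMorphism.

Lemma sum_neq0P (V : zmodType) (I : finType) (P : pred I) (F : I -> V) :
  \sum_(i | P i) F i != 0 -> exists2 i, P i & F i != 0.
Proof.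
move=> H; apply/exists_inP; apply: contraNT H => /exists_inPn H.
by rewrite big1 // => i /H; rewrite negbK => /eqP.
Qed.

(** * Additive extension from monomials to polynomials *)

Section MonomialExtension.

Variables (k : nat) (R : nzRingType) (V : zmodType).

(** The function [F] takes the coefficient as an argument, and additivity in it is what will be
    asked: for [lam] and [rep] the target is not given as a module over [R]. *)
Definition mlin (F : 'X_{1..k} -> R -> V) (p : {mpoly R[k]}) : V :=
  \sum_(m <- msupp p) F m p@_m.

Variable F : 'X_{1..k} -> R -> V.
Hypothesis F_additive : forall m, zmod_morphism (F m).

Let F0 m : F m 0 = 0.
Proof. exact: zmod_morphism0. Qed.

(** Summing over all monomials below a common bound gives several polynomials the same index set;
    the added terms are [F m 0 = 0]. *)
Lemma mlinwE w p : (msize p <= w)%N ->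
  mlin F p = \sum_(m : 'X_{1..k < w}) F m p@_m.
Proof.
move=> pw; set I : subFinType _ := 'X_{1..k < w}.
rewrite /mlin (big_mksub I) ?msupp_uniq //=; last first.
  by move=> m /msize_mdeg_lt /leq_trans; apply.
by rewrite big_rmcond //= => i; rewrite mcoeff_msupp negbK => /eqP ->.
Qed.

Lemma mlin_additive : zmod_morphism (mlin F).
Proof.
move=> p q; pose w := maxn (msize (p - q)) (maxn (msize p) (msize q)).
rewrite !(mlinwE (w := w)) /w ?leq_max ?leqnn ?orbT // -sumrB.
by apply: eq_bigr => m _; rewrite mcoeffB F_additive.
Qed.

Lemma mlinZX c m : mlin F (c *: 'X_[m]) = F m c.
Proof.
rewrite /mlin; have [->|c0] := eqVneq c 0.
  by rewrite scale0r msupp0 big_nil F0.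
by rewrite msuppMCX // big_seq1 mcoeffZ mcoeffX eqxx mulr1.
Qed.

End MonomialExtension.

(** * Induction on polynomials and Euler's identity *)

Section Induction.
Variables (k : nat) (R : comNzRingType).

Lemma mpoly_monomial_ind (S : {mpoly R[k]} -> Prop) :
    S 0 -> (forall p q, S p -> S q -> S (p + q)) ->
    (forall c m, S (c *: 'X_[m])) -> forall p, S p.
Proof. by move=> S0 SD SX; apply: mpolyind => // c m p _ _ Sp; apply: SD. Qed.

(** Suited to identities about the multiplicative map [subst], whose values on constants and
    variables are explicit. *)
Lemma mpoly_ring_ind (S : {mpoly R[k]} -> Prop) :
    (forall c, S c%:MP) -> (forall i, S 'X_i) ->
    (forall p q, S p -> S q -> S (p + q)) ->
    (forall p q, S p -> S q -> S (p * q)) -> forall p, S p.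
Proof.
move=> SC SX SD SM; apply: mpoly_monomial_ind => // [|c m].
  by rewrite -mpolyC0.
rewrite -mul_mpolyC; apply: (SM) => //; rewrite mpolyXE_id.
elim/big_ind: _ => // [|i _]; first by rewrite -mpolyC1.
by elim: (m i) => [|e IH]; rewrite ?expr0 -?mpolyC1 // exprS; apply: SM.
Qed.

Lemma mulX_mderivX i m :
  'X_i * ('X_[m])^`M(i) = (m i)%:R *: 'X_[m] :> {mpoly R[k]}.
Proof.
(* Subtraction of exponents is truncated, so adding the variable back restores [m] only if [m i] is
   positive; otherwise the coefficient is zero. *)
rewrite mderivX -scalerAr -mpolyXD; have [->|mi] := eqVneq (m i) 0%N.
  by rewrite !scale0r.
by rewrite addmC submK //; apply/mnm_lepP => j; rewrite mnm1E; case: eqP => // <-; rewrite lt0n.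
Qed.

Lemma mderivXU (j l : 'I_k) : ('X_l)^`M(j) = (l == j)%:R :> {mpoly R[k]}.
Proof.
rewrite mderivX mnm1E; case: eqP => [->|_]; last by rewrite scale0r.
have -> : (U_(j) - U_(j) = 0 :> 'X_{1..k})%MM by apply/mnmP => i; rewrite mnmBE subnn mnm0E.
by rewrite mpolyX0 scale1r.
Qed.

Lemma mpolyX_euler m :
  \sum_i 'X_i * ('X_[m])^`M(i) = (mdeg m)%:R *: 'X_[m] :> {mpoly R[k]}.
Proof.
by under eq_bigr do rewrite mulX_mderivX; rewrite -scaler_suml mdegE natr_sum.
Qed.

Lemma dhomog_euler (p : {mpoly R[k]}) e : p \is e.-homog ->
  \sum_i 'X_i * p^`M(i) = p *+ e.
Proof.
move=> hp; rewrite {2}[p]mpolyE -sumrMnl.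
transitivity (\sum_i \sum_(m <- msupp p) p@_m *: ('X_i * ('X_[m])^`M(i))).
  apply: eq_bigr => i _; rewrite {1}[p]mpolyE raddf_sum mulr_sumr /=.
  by apply: eq_bigr => m _; rewrite mderivZ scalerAr.
rewrite exchange_big; apply: eq_big_seq => m mp.
by rewrite -scaler_sumr mpolyX_euler (dhomog_mf hp mp) scaler_nat scalerMnr.
Qed.

Lemma dhomog0_mderiv (p : {mpoly R[k]}) i : p \is 0.-homog -> p^`M(i) = 0.
Proof.
move=> hp; apply/mpolyP => m; rewrite mcoeff_deriv mcoeff0.
by rewrite (dhomog_nemf_coeff hp) ?mul0rn //= mdegD mdeg1 addn1.
Qed.

End Induction.

(** * The pairing by differentiation *)

Section Pairing.
Variables (K : fieldType) (n : nat).
Implicit Types (h p q : {mpoly K[n]}).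

Let diffop_summand p (m : 'X_{1..n}) : zmod_morphism (fun c : K => c *: p^`M[m]).
Proof. by move=> a c; rewrite scalerBl. Qed.

Lemma diffop_additive p : zmod_morphism (fun h => diffop h p).
Proof. exact: (mlin_additive (diffop_summand p)). Qed.

Lemma diffopZX c m p : diffop (c *: 'X_[m]) p = c *: p^`M[m].
Proof. exact: (mlinZX (diffop_summand p)). Qed.

Lemma diffopDl p h q : diffop (h + q) p = diffop h p + diffop q p.
Proof. exact: (zmod_morphismD (diffop_additive p)). Qed.

Lemma diffop0l p : diffop 0 p = 0.
Proof. exact: (zmod_morphism0 (diffop_additive p)). Qed.

Lemma diffopDr h p q : diffop h (p + q) = diffop h p + diffop h q.
Proof.
rewrite /diffop -big_split; apply: eq_bigr => m _.
by rewrite mderivmD scalerDr.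
Qed.

Lemma diffopZr h c p : diffop h (c *: p) = c *: diffop h p.
Proof.
rewrite /diffop scaler_sumr; apply: eq_bigr => m _.
by rewrite mderivmZ !scalerA mulrC.
Qed.

Lemma diffop0r h : diffop h 0 = 0.
Proof. by rewrite -(scale0r (0 : {mpoly K[n]})) diffopZr !scale0r. Qed.

Lemma diffop_sumr h (I : Type) (s : seq I) (F : I -> {mpoly K[n]}) :
  diffop h (\sum_(i <- s) F i) = \sum_(i <- s) diffop h (F i).
Proof. by elim/big_rec2: _ => [|i x y _ <-]; rewrite ?diffop0r ?diffopDr. Qed.

Lemma diffopM h q p : diffop (h * q) p = diffop h (diffop q p).
Proof.
elim/mpoly_monomial_ind: h => [|h1 h2 e1 e2|c m].
- by rewrite mul0r !diffop0l.
- by rewrite mulrDl !diffopDl e1 e2.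
elim/mpoly_monomial_ind: q => [|q1 q2 e1 e2|a l].
- by rewrite mulr0 !diffop0l diffop0r.
- by rewrite mulrDr !diffopDl diffopDr e1 e2.
rewrite -scalerAl -scalerAr -mpolyXD scalerA !diffopZX mderivmZ scalerA.
by rewrite addmC mderivmDm.
Qed.

Lemma diffopX i p : diffop 'X_i p = p^`M(i).
Proof. by rewrite -['X_i]scale1r diffopZX scale1r mderivmU1m. Qed.

(** The apolar, or Fischer, pairing. *)
Definition mpair h p : K := (diffop h p)@_0.

Lemma mpair_additive p : zmod_morphism (fun h => mpair h p).
Proof. by move=> h q; rewrite /mpair diffop_additive mcoeffB. Qed.

Lemma mpairZXl c m p :
  mpair (c *: 'X_[m]) p = c * (p@_m *+ \prod_i (m i)`!).
Proof.
rewrite /mpair diffopZX mcoeffZ mcoeff_mderivm addm0.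
by congr (_ * (_ *+ _)); apply: eq_bigr => i _; rewrite ffactnn.
Qed.

Lemma mpairDl p h q : mpair (h + q) p = mpair h p + mpair q p.
Proof. by rewrite /mpair diffopDl mcoeffD. Qed.

Lemma mpairDr h p q : mpair h (p + q) = mpair h p + mpair h q.
Proof. by rewrite /mpair diffopDr mcoeffD. Qed.

Lemma mpair0l p : mpair 0 p = 0.
Proof. by rewrite /mpair diffop0l mcoeff0. Qed.

Lemma mpair0r h : mpair h 0 = 0.
Proof. by rewrite /mpair diffop0r mcoeff0. Qed.

Lemma mpairMnl h p e : mpair h p *+ e = mpair (h *+ e) p.
Proof.
elim: e => [|e IH]; first by rewrite !mulr0n mpair0l.
by rewrite !mulrSr mpairDl IH.
Qed.

Lemma mpair_sumr h (I : Type) (s : seq I) (F : I -> {mpoly K[n]}) :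
  mpair h (\sum_(i <- s) F i) = \sum_(i <- s) mpair h (F i).
Proof. by rewrite /mpair diffop_sumr raddf_sum. Qed.

(** By additivity this reduces to monomials, and distinct monomials are orthogonal. *)
Lemma mpairC h p : mpair h p = mpair p h.
Proof.
elim/mpoly_monomial_ind: h => [|h1 h2 e1 e2|c m]; first by rewrite mpair0l mpair0r.
  by rewrite mpairDl mpairDr e1 e2.
elim/mpoly_monomial_ind: p => [|h1 h2 e1 e2|a l]; first by rewrite mpair0l mpair0r.
  by rewrite mpairDl mpairDr e1 e2.
rewrite !mpairZXl !mcoeffZ !mcoeffX [m == l]eq_sym.
case: eqP => [->|_]; last by rewrite !mulr0 !mul0rn !mulr0.
by rewrite !mulr1 !mulrnAr mulrC.
Qed.

Lemma mpairMnr h p e : mpair h p *+ e = mpair h (p *+ e).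
Proof. by rewrite mpairC mpairMnl mpairC. Qed.

Lemma mpairMl h q p : mpair (h * q) p = mpair h (diffop q p).
Proof. by rewrite /mpair diffopM. Qed.

(** With [mpair_Xr], the adjunction through which the recursion and Euler's identity enter the
    computations with [lam]. *)
Lemma mpair_Xl i h p : mpair ('X_i * h) p = mpair h p^`M(i).
Proof. by rewrite mulrC mpairMl diffopX. Qed.

Lemma mpair_Xr i h p : mpair h ('X_i * p) = mpair h^`M(i) p.
Proof. by rewrite mpairC mpair_Xl mpairC. Qed.

Lemma mpair_dhomog e h p : p \is e.-homog ->
  (forall m, h@_m != 0 -> mdeg m != e) -> mpair h p = 0.
Proof.
move=> hp hh; rewrite mpairC (mpolyE h) mpair_sumr big_seq big1 // => m.
rewrite mcoeff_msupp => /hh me.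
by rewrite mpairC mpairZXl (dhomog_nemf_coeff hp me) mul0rn mulr0.
Qed.

End Pairing.

(** * Derivations acting on coefficients *)

Section CoefficientDerivation.
Variables (k : nat) (R : comNzRingType) (D : {additive R -> R}).
Hypothesis D_leibniz : forall a b, D (a * b) = D a * b + a * D b.
Implicit Types p q : {mpoly R[k]}.

Lemma derivation1 : D 1 = 0.
Proof.
by apply: (addIr (D 1)); rewrite add0r -{3}[1]mulr1 D_leibniz mulr1 mul1r.
Qed.

Lemma map_derivZX a m : map_mpoly D (a *: 'X_[m] : {mpoly R[k]}) = D a *: 'X_[m].
Proof.
apply/mpolyP => l; rewrite mcoeff_map_mpoly !mcoeffZ !mcoeffX.
by case: (m == l); rewrite ?mulr1 ?mulr0 ?raddf0.
Qed.

Lemma map_derivX m : map_mpoly D ('X_[m] : {mpoly R[k]}) = 0.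
Proof. by have := map_derivZX 1 m; rewrite scale1r derivation1 scale0r. Qed.

Lemma map_derivM p q :
  map_mpoly D (p * q) = map_mpoly D p * q + p * map_mpoly D q.
Proof.
have DD (x y : {mpoly R[k]}) : map_mpoly D (x + y) = map_mpoly D x + map_mpoly D y.
  exact: raddfD.
have XX (a b : R) (m l : 'X_{1..k}) :
    (a *: 'X_[m]) * (b *: 'X_[l]) = (a * b) *: 'X_[m + l] :> {mpoly R[k]}.
  by rewrite -scalerAl -scalerAr scalerA mpolyXD.
elim/mpoly_monomial_ind: p => [|x y ex ey|a m].
- by rewrite mul0r !raddf0 !mul0r addr0.
- by rewrite mulrDl !DD ex ey !mulrDl addrACA.
elim/mpoly_monomial_ind: q => [|x y ex ey|b l].
- by rewrite mulr0 !raddf0 !mulr0 addr0.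
- by rewrite mulrDr !DD ex ey !mulrDr addrACA.
by rewrite XX !map_derivZX !XX D_leibniz scalerDl.
Qed.

End CoefficientDerivation.

(** * The module B_g *)

Section Derivations.
Variables (K : fieldType) (n r : nat).
Local Notation A := {mpoly {mpoly K[n]}[r]}.
Implicit Types xi eta : A.

Definition cderiv (i : 'I_n) xi : A := map_mpoly (mderiv i) xi.

Lemma mcoeff_cderiv i xi m : (cderiv i xi)@_m = (xi@_m)^`M(i).
Proof. exact: mcoeff_map_mpoly. Qed.

Lemma cderivD i xi eta : cderiv i (xi + eta) = cderiv i xi + cderiv i eta.
Proof. exact: raddfD. Qed.

Lemma cderiv0 i : cderiv i 0 = 0.
Proof. exact: raddf0. Qed.

Lemma cderiv_sum i (I : Type) (s : seq I) (F : I -> A) :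
  cderiv i (\sum_(j <- s) F j) = \sum_(j <- s) cderiv i (F j).
Proof. by elim/big_rec2: _ => [|j x y _ <-]; rewrite ?cderiv0 ?cderivD. Qed.

Let mderiv_leibniz (i : 'I_n) (p q : {mpoly K[n]}) :
  mderiv i (p * q) = mderiv i p * q + p * mderiv i q.
Proof. exact: mderivM. Qed.

Lemma cderivZX i h m : cderiv i (h *: 'X_[m]) = h^`M(i) *: 'X_[m].
Proof. exact: map_derivZX. Qed.

Lemma cderivC i h : cderiv i h%:MP = (h^`M(i))%:MP.
Proof. exact: map_mpolyC. Qed.

Lemma cderivX i m : cderiv i 'X_[m] = 0.
Proof. exact: (map_derivX (mderiv_leibniz i)). Qed.

Lemma cderivM i xi eta :
  cderiv i (xi * eta) = cderiv i xi * eta + xi * cderiv i eta.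
Proof. exact: (map_derivM (mderiv_leibniz i)). Qed.

Lemma cderivZ i h xi : cderiv i (h *: xi) = h^`M(i) *: xi + h *: cderiv i xi.
Proof. by rewrite -mul_mpolyC cderivM cderivC !mul_mpolyC. Qed.

Lemma cderiv_mderiv i j xi : cderiv i (xi^`M(j)) = (cderiv i xi)^`M(j).
Proof.
apply/mpolyP => m.
by rewrite mcoeff_cderiv !mcoeff_deriv mcoeff_cderiv mderivMn.
Qed.

Definition eul xi : A := \sum_j 'X_j * xi^`M(j).

Lemma eulD xi eta : eul (xi + eta) = eul xi + eul eta.
Proof. by rewrite -big_split; apply: eq_bigr => j _; rewrite mderivD mulrDr. Qed.

Lemma eul_sum (I : Type) (s : seq I) (F : I -> A) :
  eul (\sum_(j <- s) F j) = \sum_(j <- s) eul (F j).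
Proof.
have eul0 : eul 0 = 0 by apply: (addIr (eul 0)); rewrite -eulD !add0r.
by elim/big_rec2: _ => [|j x y _ <-]; rewrite ?eulD.
Qed.

Lemma eulM xi eta : eul (xi * eta) = eul xi * eta + xi * eul eta.
Proof.
rewrite /eul mulr_suml mulr_sumr -big_split; apply: eq_bigr => j _.
have ringE (S : comNzRingType) (x a b c d : S) :
  x * (a * b + c * d) = x * a * b + c * (x * d) by ring.
by rewrite mderivM; exact: ringE.
Qed.

Lemma eulZX h m : eul (h *: 'X_[m]) = (mdeg m)%:R *: (h *: 'X_[m]).
Proof.
rewrite /eul; under eq_bigr do rewrite mderivZ -scalerAr.
by rewrite -scaler_sumr mpolyX_euler !scalerA mulrC.
Qed.

Lemma eulC h : eul h%:MP = 0.
Proof. by rewrite /eul big1 // => j _; rewrite mderivC mulr0. Qed.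

Lemma eulZ h xi : eul (h *: xi) = h *: eul xi.
Proof. by rewrite -!mul_mpolyC eulM eulC mul0r add0r. Qed.

Lemma eulX j : eul 'X_j = 'X_j.
Proof. by have := eulZX 1 U_(j)%MM; rewrite mdeg1 !scale1r. Qed.

(* An element [h *: 'X_[m]] stands for h (- d/dt)^m delta(t - g); the operators
   below are the actions of t_j, of d/dx_i and of s_1 + ... + s_r. *)
Section Operators.
Variable g : 'I_r -> {mpoly K[n]}.

Definition opt (j : 'I_r) xi : A := g j *: xi + xi^`M(j).
Definition opts (js : seq 'I_r) xi : A := foldr opt xi js.
Definition opd (i : 'I_n) xi : A :=
  cderiv i xi + (\sum_j (g j)^`M(i) *: 'X_j) * xi.
Definition ops xi : A := \sum_j 'X_j * opt j xi.

(** Separates multiplication by a linear form from an Euler operator; [subst] and [lam] are then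
    computed on each part. *)
Lemma opsE xi : ops xi = (\sum_j g j *: 'X_j) * xi + eul xi.
Proof.
rewrite /ops /eul mulr_suml -big_split; apply: eq_bigr => j _.
by rewrite mulrDr -scalerAr scalerAl.
Qed.

Lemma optD j xi eta : opt j (xi + eta) = opt j xi + opt j eta.
Proof. by rewrite /opt scalerDr mderivD addrACA. Qed.

Lemma optZ j h xi : opt j (h *: xi) = h *: opt j xi.
Proof. by rewrite /opt mderivZ scalerDr !scalerA mulrC. Qed.

Lemma optsD js xi eta : opts js (xi + eta) = opts js xi + opts js eta.
Proof. by elim: js => //= j js ->; rewrite optD. Qed.

Lemma optsZ js h xi : opts js (h *: xi) = h *: opts js xi.
Proof. by elim: js => //= j js ->; rewrite optZ. Qed.

Lemma optC j l xi : opt j (opt l xi) = opt l (opt j xi).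
Proof.
have lmodE (S : comNzRingType) (V : lmodType S) (a b : S) (x y z w : V) :
  a *: (b *: x + y) + (b *: z + w) = b *: (a *: x + z) + (a *: y + w).
  by rewrite !scalerDr !scalerA mulrC -!addrA; congr (_ + _); rewrite addrCA.
rewrite /opt [in LHS]mderivD [in RHS]mderivD [in LHS]mderivZ [in RHS]mderivZ.
by rewrite (mderiv_comm l); exact: lmodE.
Qed.

Lemma opt_opd j i xi : opt j (opd i xi) = opd i (opt j xi).
Proof.
rewrite /opt /opd; set a := \sum_l _.
(* Differentiating the linear form by ['X_j] yields the same term as [cderiv i] applied to the
   coefficient [g j], so the two orders agree. *)
have aD : a^`M(j) = ((g j)^`M(i))%:MP.
  rewrite /a raddf_sum (bigD1 j) //= big1 => [|l lj].
    by rewrite mderivZ mderivXU eqxx alg_mpolyC addr0.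
  by rewrite mderivZ mderivXU (negPf lj) scaler0.
have ringE (S : comNzRingType) (G G' b x xj cx cxj : S) :
    G * (cx + b * x) + (cxj + (G' * x + b * xj)) =
    G' * x + G * cx + cxj + b * (G * x + xj) by ring.
rewrite mderivD mderivM aD cderivD cderivZ cderiv_mderiv -!mul_mpolyC.
exact: ringE.
Qed.

Lemma opts_opd js i xi : opts js (opd i xi) = opd i (opts js xi).
Proof. by elim: js => [|j js IH] /=; [|rewrite IH opt_opd]. Qed.

(** The Weyl algebra relation between t_l and - d/dt_j. *)
Lemma opt_mulX l j xi : opt l ('X_j * xi) = 'X_j * opt l xi + (j == l)%:R *: xi.
Proof.
have ringE (S : comNzRingType) (G x y z e : S) :
  G * (x * y) + (e * y + x * z) = x * (G * y + z) + e * y by ring.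
by rewrite /opt mderivM mderivXU -!mul_mpolyC mpolyC_nat; exact: ringE.
Qed.

(** Each occurrence of [j] in [js] contributes one commutator. The t_j of s_j joins the list, which
    makes up for the extra factor ['X_j] in [vanish_s]. *)
Lemma opts_mulX_opt js j xi : opts js ('X_j * opt j xi) =
  'X_j * opts (j :: js) xi + (count_mem j js)%:R *: opts js xi.
Proof.
have lmodE (S : comNzRingType) (V : lmodType S) (a : S) (N : nat) (x y : V) :
  x + a *: y + N%:R *: y = x + (a + N%:R) *: y by rewrite scalerDl addrA.
elim: js => [|l js IH] /=; first by rewrite scale0r addr0.
rewrite IH optD optZ opt_mulX (optC l j) (eq_sym l j) natrD.
case: (eqVneq j l) => [->|_] /=; first exact: lmodE.
by rewrite scale0r addr0 add0r.
Qed.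

End Operators.
End Derivations.

(** * Order filtration and change of generators *)

Section Filtration.
Variables (K : fieldType) (n r d : nat).
Local Notation A := {mpoly {mpoly K[n]}[r]}.
Implicit Types xi eta : A.

(* x has weight 1 and d/dt_j weight - d: all terms have weight at least e. *)
Definition fil (e : int) xi := forall (m : 'X_{1..r}) (l : 'X_{1..n}),
  (xi@_m)@_l != 0 -> e + (d * mdeg m)%N%:Z <= (mdeg l)%:Z.

Lemma fil0 e : fil e 0.
Proof. by move=> m l; rewrite !mcoeff0 eqxx. Qed.

Lemma filD e xi eta : fil e xi -> fil e eta -> fil e (xi + eta).
Proof.
move=> fx fe m l; rewrite !mcoeffD => H.
have [x0|] := eqVneq ((xi@_m)@_l) 0; last exact: fx.
by apply: fe; move: H; rewrite x0 add0r.
Qed.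

Lemma fil_sum e (I : Type) (s : seq I) (F : I -> A) :
  (forall i, fil e (F i)) -> fil e (\sum_(i <- s) F i).
Proof.
move=> fF; elim/big_rec: _ => [|i x _ fx]; first exact: fil0.
exact: filD.
Qed.

Lemma filM e e' xi eta : fil e xi -> fil e' eta -> fil (e + e') (xi * eta).
Proof.
move=> fx fe m l; rewrite mcoeffM raddf_sum.
case/sum_neq0P => -[m1 m2] /= /eqP mE; rewrite mcoeffM.
case/sum_neq0P => -[l1 l2] /= /eqP lE.
rewrite mulf_eq0 negb_or => /andP[/fx H1 /fe H2].
have := congr1 mdeg mE; have := congr1 mdeg lE; rewrite !mdegD.
move: H1 H2; lia.
Qed.

Lemma filZX e h m : (forall l, h@_l != 0 -> e + (d * mdeg m)%N%:Z <= (mdeg l)%:Z) ->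
  fil e (h *: 'X_[m]).
Proof.
move=> hh m' l; rewrite mcoeffZ mcoeffX; case: (eqVneq m m') => [<-|_].
  by rewrite mulr1; apply: hh.
by rewrite mulr0 mcoeff0 eqxx.
Qed.

Lemma filC e h : (forall l, h@_l != 0 -> e <= (mdeg l)%:Z) -> fil e h%:MP.
Proof.
move=> hh; rewrite -[h%:MP]mulr1 -mpolyX0 mul_mpolyC.
by apply: filZX => l /hh; rewrite mdeg0 muln0 addr0.
Qed.

Lemma filZ h e xi : fil e xi -> fil e (h *: xi).
Proof.
move=> fx; rewrite -mul_mpolyC -[e]add0r; apply: filM => //.
by apply: filC => l _; lia.
Qed.

Lemma fil_X j : fil (- d%:Z) 'X_j.
Proof. by rewrite -['X_j]scale1r; apply: filZX => l _; rewrite mdeg1; lia. Qed.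

Lemma fil_expr k xi : fil (- d%:Z) xi -> fil (- (d * k)%N%:Z) (xi ^+ k).
Proof.
move=> fx; elim: k => [|k IH].
  by rewrite expr0 -mpolyC1; apply: filC => l _; lia.
have -> : - (d * k.+1)%N%:Z = - d%:Z + - (d * k)%N%:Z by lia.
by rewrite exprS; apply: filM.
Qed.

Lemma fil_prod (k : nat) (F : 'I_k -> A) (m : 'X_{1..k}) :
  (forall i, fil (- d%:Z) (F i)) ->
  fil (- (d * mdeg m)%N%:Z) (\prod_i F i ^+ m i).
Proof.
move=> fF; rewrite mdegE.
apply: (big_ind2 (fun a xi => fil (- (d * a)%N%:Z) xi)) => [|a x b y fx fy|i _].
- by rewrite -mpolyC1; apply: filC => l _; lia.
- have -> : - (d * (a + b))%N%:Z = - (d * a)%N%:Z + - (d * b)%N%:Z by lia.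
  exact: filM.
- exact: fil_expr.
Qed.

Lemma fil_mderiv e j xi : fil e xi -> fil (e + d%:Z) (xi^`M(j)).
Proof.
move=> fx m l; rewrite mcoeff_deriv mcoeffMn => H.
have/fx : (xi@_(m + U_(j)))@_l != 0.
  by apply: contraNneq H => ->; rewrite mul0rn.
rewrite mdegD mdeg1; lia.
Qed.

End Filtration.

(** * The substitution attached to a change of generators *)

Section Substitution.
Variables (K : fieldType) (n r s d : nat).
Local Notation A := {mpoly {mpoly K[n]}[r]}.
Local Notation B := {mpoly {mpoly K[n]}[s]}.
Variables (f : 'I_s -> {mpoly K[n]}) (g : 'I_r -> {mpoly K[n]}).
Variables (c : 'I_s -> 'I_r -> {mpoly K[n]}).
Hypothesis f_comb : forall k, f k = \sum_j c k j * g j.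

Definition sublin (j : 'I_r) : B := \sum_k c k j *: 'X_k.
(* Locked: otherwise failing unification attempts unfold it at great cost. *)
Definition subst : A -> B :=
  locked (fun xi : A => xi \mPo [tuple sublin j | j < r]).

Lemma substP xi : subst xi = xi \mPo [tuple sublin j | j < r].
Proof. by rewrite /subst -lock. Qed.

Lemma substX j : subst 'X_j = sublin j.
Proof. by rewrite substP comp_mpolyXU -tnth_nth tnth_mktuple. Qed.

Lemma substC h : subst h%:MP = h%:MP.
Proof. by rewrite substP comp_mpolyC. Qed.

Lemma substD x y : subst (x + y) = subst x + subst y.
Proof. by rewrite !substP; exact: comp_mpolyD. Qed.

Lemma subst0 : subst 0 = 0.
Proof. by rewrite substP; exact: comp_mpoly0. Qed.

Lemma subst_sum (I : Type) (t : seq I) (F : I -> A) :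
  subst (\sum_(i <- t) F i) = \sum_(i <- t) subst (F i).
Proof. by elim/big_rec2: _ => [|i x y _ <-]; rewrite ?subst0 ?substD. Qed.

Lemma substM x y : subst (x * y) = subst x * subst y.
Proof. by rewrite !substP; exact: rmorphM. Qed.

Lemma substZ h x : subst (h *: x) = h *: subst x.
Proof. by rewrite !substP; exact: comp_mpolyZ. Qed.

Lemma fil_sublin j : fil d (- d%:Z) (sublin j).
Proof. by apply: fil_sum => k; apply: filZ; apply: fil_X. Qed.

Lemma fil_subst e xi : fil d e xi -> fil d e (subst xi).
Proof.
move=> fx; rewrite substP comp_mpolyE; apply: fil_sum => m.
rewrite -mul_mpolyC.
(* The coefficient of ['X_[m]] has order at least [e + d * mdeg m], and each of the [mdeg m] linear
   forms lowers the weight by at most [d]. *)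
have -> : e = (e + (d * mdeg m)%N%:Z) + - (d * mdeg m)%N%:Z by lia.
apply: filM; first by apply: filC => l; exact: fx.
by apply: fil_prod => j; rewrite tnth_mktuple; apply: fil_sublin.
Qed.

Lemma subst_mderivX (l j : 'I_r) : subst ('X_l)^`M(j) = (l == j)%:R.
Proof.
by rewrite mderivXU; case: eqP => _; rewrite ?subst0 // -mpolyC1 substC.
Qed.

(** The chain rule: the substituted forms depend on x through the [c k j]. *)
Lemma cderiv_subst i xi : cderiv i (subst xi) =
  subst (cderiv i xi) + \sum_j cderiv i (sublin j) * subst xi^`M(j).
Proof.
have ringE (S : comNzRingType) (cx x sx cy y sy : S) :
  (cx + sx) * y + x * (cy + sy) = (cx * y + x * cy) + (sx * y + x * sy) by ring.
have ringE' (S : comNzRingType) (L a b y z : S) :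
  L * a * y + z * (L * b) = L * (a * y + z * b) by ring.
elim/mpoly_ring_ind: xi => [h|l|x y ex ey|x y ex ey].
- rewrite substC !cderivC substC big1 ?addr0 // => j _.
  by rewrite mderivC subst0 mulr0.
- rewrite substX cderivX subst0 add0r (bigD1 l) //= big1 => [|j jl].
    by rewrite subst_mderivX eqxx mulr1 addr0.
  by rewrite subst_mderivX eq_sym (negPf jl) mulr0.
- rewrite (substD x) (cderivD i (subst x)) ex ey (cderivD i x).
  rewrite (substD (cderiv i x)) [LHS]addrACA.
  congr (_ + _); rewrite -big_split; apply: eq_bigr => j _.
  by rewrite (mderivD j x) (substD x^`M(j)) mulrDr.
rewrite (substM x) (cderivM i (subst x)) ex ey ringE (cderivM i x).
rewrite (substD (cderiv i x * y)) (substM (cderiv i x)) (substM x).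
congr (_ + _).
rewrite mulr_suml mulr_sumr -big_split; apply: eq_bigr => j _.
rewrite (mderivM j x) (substD (x^`M(j) * y)) (substM x^`M(j)) (substM x).
exact: ringE'.
Qed.

Lemma eul_sublin j : eul (sublin j) = sublin j.
Proof. by rewrite /sublin eul_sum; apply: eq_bigr => k _; rewrite eulZ eulX. Qed.

(** Holds because the substituted forms are homogeneous of degree 1 in d/dt. *)
Lemma eul_subst xi : eul (subst xi) = subst (eul xi).
Proof.
elim/mpoly_ring_ind: xi => [h|l|x y ex ey|x y ex ey].
- by rewrite substC !eulC subst0.
- by rewrite eulX substX eul_sublin.
- by rewrite (eulD x) (substD x) (substD (eul x)) (eulD (subst x)) ex ey.
- rewrite (eulM x) (substM x) (eulM (subst x)) (substD (eul x * y)).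
  by rewrite (substM (eul x)) (substM x) ex ey.
Qed.

Lemma subst_linear_form (a : 'I_r -> {mpoly K[n]}) :
  subst (\sum_j a j *: 'X_j) = \sum_j a j *: sublin j.
Proof. by rewrite subst_sum; apply: eq_bigr => j _; rewrite substZ substX. Qed.

Lemma subst_ops xi : subst (ops g xi) = ops f (subst xi).
Proof.
rewrite !opsE substD substM eul_subst subst_linear_form; congr (_ * _ + _).
under eq_bigr do rewrite scaler_sumr; rewrite exchange_big /=.
apply: eq_bigr => k _; rewrite f_comb scaler_suml.
by apply: eq_bigr => j _; rewrite scalerA mulrC.
Qed.

(** Two defects arise: the chain rule term of [cderiv_subst], and the terms g_j d_i(c_kj) in the
    derivative of f_k. Together they form the two halves of [opt g j], multiplied by the derivative
    of [sublin j]. *)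
Lemma subst_opd i xi : subst (opd g i xi) =
  opd f i (subst xi) - \sum_j cderiv i (sublin j) * subst (opt g j xi).
Proof.
(* Product rule for f_k = \sum_j c_kj g_j: the first sum is the image of the linear form in
   [opd g i], the second is a defect. *)
have fE : \sum_k (f k)^`M(i) *: 'X_k = \sum_j (g j)^`M(i) *: sublin j
    + \sum_j (g j)%:MP * cderiv i (sublin j) :> B.
  rewrite -big_split /=.
  transitivity (\sum_k \sum_j (c k j * g j)^`M(i) *: 'X_k : B).
    by apply: eq_bigr => k _; rewrite f_comb raddf_sum scaler_suml.
  rewrite exchange_big; apply: eq_bigr => j _.
  rewrite /sublin scaler_sumr cderiv_sum mulr_sumr -big_split.
  apply: eq_bigr => k _; rewrite cderivZX mul_mpolyC !scalerA /= -scalerDl mderivM.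
  by congr (_ *: _); rewrite addrC mulrC [g j * _]mulrC.
rewrite /opd substD substM subst_linear_form fE cderiv_subst.
have -> : \sum_j cderiv i (sublin j) * subst (opt g j xi) =
   \sum_j cderiv i (sublin j) * subst xi^`M(j) +
   (\sum_j (g j)%:MP * cderiv i (sublin j)) * subst xi.
  rewrite mulr_suml -big_split; apply: eq_bigr => j _.
  rewrite /opt substD substZ -mul_mpolyC.
  by rewrite mulrDr addrC; congr (_ + _); rewrite mulrCA mulrA.
have ringE (S : comNzRingType) (a b u v y : S) :
  a + u * y = (a + b) + (u + v) * y - (b + v * y) by ring.
exact: ringE.
Qed.

End Substitution.

(** * The functional *)

Section Functional.
Variables (K : fieldType) (n r d : nat).
Local Notation A := {mpoly {mpoly K[n]}[r]}.
Variables (f : 'I_r -> {mpoly K[n]}) (P : 'X_{1..r} -> {mpoly K[n]}).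
Hypothesis f_hom : forall k, f k \is d.-homog.
Hypothesis P_hom : forall m, P m \is (d * mdeg m).-homog.
Hypothesis P_rec : forall (i : 'I_n) (m : 'X_{1..r}),
  'X_i * P m = \sum_(k < r) diffop (f k)^`M(i) (P (m + U_(k))%MM).
Implicit Types xi eta : A.

(** The sign is there because ['X_[m]] stands for a power of - d/dt. *)
Let lam_summand m h : K := (-1) ^+ mdeg m * mpair h (P m).

Definition lam : A -> K := locked (mlin lam_summand).

Lemma lamE xi : lam xi = mlin lam_summand xi.
Proof. by rewrite /lam -lock. Qed.

Let lam_summand_additive m : zmod_morphism (lam_summand m).
Proof. by move=> x y; rewrite /lam_summand mpair_additive mulrBr. Qed.

Lemma lam_additive : zmod_morphism lam.
Proof. by move=> x y; rewrite !lamE (mlin_additive lam_summand_additive). Qed.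

Lemma lamD x y : lam (x + y) = lam x + lam y.
Proof. exact: zmod_morphismD lam_additive _ _. Qed.

Lemma lam0 : lam 0 = 0.
Proof. exact: zmod_morphism0 lam_additive. Qed.

Lemma lam_sum (I : Type) (t : seq I) (F : I -> A) :
  lam (\sum_(i <- t) F i) = \sum_(i <- t) lam (F i).
Proof. exact: zmod_morphism_sum lam_additive _ _ _ _. Qed.

Lemma lamZX h m : lam (h *: 'X_[m]) = (-1) ^+ mdeg m * mpair h (P m).
Proof. by rewrite lamE (mlinZX lam_summand_additive). Qed.

Lemma lamZ (a : K) xi : lam (a%:MP *: xi) = a * lam xi.
Proof.
elim/mpoly_monomial_ind: xi => [|x y ex ey|h m].
- by rewrite scaler0 lam0 mulr0.
- by rewrite scalerDr lamD (lamD x) ex ey mulrDr.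
rewrite scalerA !lamZX mul_mpolyC mpairC (mpairC h) /mpair diffopZr mcoeffZ.
by rewrite mulrCA.
Qed.

Lemma lam_nat k xi : lam (k%:R *: xi) = k%:R * lam xi.
Proof. by rewrite -lamZ mpolyC_nat. Qed.

(** The coefficient of ['X_[m]] has order greater than [d * mdeg m], the degree of [P m]. *)
Lemma lam_fil1 xi : fil d 1 xi -> lam xi = 0.
Proof.
move=> fx; rewrite lamE /mlin big1 // => m _; rewrite /lam_summand.
rewrite (mpair_dhomog (P_hom m)) ?mulr0 // => l /fx; lia.
Qed.

Lemma linear_formZX (a : 'I_r -> {mpoly K[n]}) h m :
  (\sum_k a k *: 'X_k) * (h *: 'X_[m]) =
  \sum_k (a k * h) *: 'X_[m + U_(k)] :> A.
Proof.
rewrite mulr_suml; apply: eq_bigr => k _.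
by rewrite -scalerAl -scalerAr scalerA -mpolyXD addmC.
Qed.

Lemma lam_linear_form a h m : lam ((\sum_k a k *: 'X_k) * (h *: 'X_[m])) =
  - ((-1) ^+ mdeg m * \sum_k mpair (a k * h) (P (m + U_(k))%MM)).
Proof.
rewrite linear_formZX lam_sum mulr_sumr -sumrN; apply: eq_bigr => k _.
by rewrite lamZX mdegD mdeg1 addn1 exprS mulN1r mulNr.
Qed.

Lemma opdD i xi eta : opd f i (xi + eta) = opd f i xi + opd f i eta.
Proof. by rewrite /opd cderivD mulrDr addrACA. Qed.

Lemma opsD xi eta : ops f (xi + eta) = ops f xi + ops f eta.
Proof. by rewrite !opsE eulD mulrDr addrACA. Qed.

(** By adjunction, d_i h pairs with P_m as h does with x_i P_m. The recursion expands the latter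
    into the terms of the linear form, which carry the opposite sign. *)
Lemma lam_opd i xi : lam (opd f i xi) = 0.
Proof.
elim/mpoly_monomial_ind: xi => [|x y ex ey|h m].
- by rewrite /opd cderiv0 mulr0 addr0 lam0.
- by rewrite (opdD i x) (lamD (opd f i x)) ex ey addr0.
rewrite /opd cderivZX lamD lamZX lam_linear_form.
rewrite -mpair_Xr P_rec mpair_sumr -mulrBr.
under [X in _ - X]eq_bigr do rewrite mulrC mpairMl.
by rewrite subrr mulr0.
Qed.

(** The factor [d] lets Euler's identity replace d f_k by \sum_i x_i d_i f_k, to which the recursion
    applies; it also avoids a division. *)
Lemma lam_ops xi : lam (ops f xi) *+ d = - (lam xi *+ n).
Proof.
elim/mpoly_monomial_ind: xi => [|x y ex ey|h m].
- have -> : ops f 0 = 0 by apply: (addIr (ops f 0)); rewrite -opsD !add0r.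
  by rewrite lam0 !mul0rn oppr0.
- rewrite (opsD x) (lamD (ops f x)) (lamD x) (mulrnDl d) (mulrnDl n) opprD.
  by congr (_ + _).
rewrite opsE eulZX lamD lam_linear_form lam_nat lamZX.
have key : (\sum_k mpair (f k * h) (P (m + U_(k))%MM)) *+ d =
    mpair h (P m) *+ n + mpair h (P m) *+ (d * mdeg m).
  (* This sum is computed twice: by the recursion and Euler's identity for [f k], and by adjunction
     and Euler's identity for [P m], where d_i x_i = x_i d_i + 1 produces the multiple [n]. *)
  transitivity (\sum_i mpair ('X_i * h) ('X_i * P m)).
    under [RHS]eq_bigr do rewrite P_rec mpair_sumr.
    rewrite exchange_big -sumrMnl; apply: eq_bigr => k _.
    under [RHS]eq_bigr do rewrite -mpairMl.
    rewrite mpairMnl -mulrnAl -(dhomog_euler (f_hom k)) mulr_suml.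
    rewrite (zmod_morphism_sum (mpair_additive _)); apply: eq_bigr => i _.
    by congr (mpair _ _); rewrite mulrAC.
  rewrite [X in _ = _ + X]mpairMnr -(dhomog_euler (P_hom m)) mpair_sumr.
  rewrite -[X in _ *+ X]card_ord -sumr_const -big_split; apply: eq_bigr => i _.
  by rewrite mpair_Xr mderivM mderivXU eqxx mul1r mpairDl mpair_Xl -mpair_Xr.
(* The Euler part of [ops] cancels the multiple [d * mdeg m]. *)
have ringE (S : comNzRingType) (e X M : S) (D N e' : nat) :
    X *+ D = M *+ N + M *+ (D * e') ->
    (- (e * X) + e'%:R * (e * M)) *+ D = - (e * M *+ N).
  move=> H; transitivity (- (e * (X *+ D)) + (D * e')%:R * (e * M)).
    by rewrite mulrnDl mulNrn mulrnAr -(mulr_natl (e'%:R * _) D) mulrA natrM.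
  by rewrite H mulrDr !mulrnAr mulr_natl opprD subrK.
exact: ringE.
Qed.

(** * Elements killed by all functionals lam (eta . t^J) *)

Section Vanishing.
Variables (t : nat) (g : 'I_t -> {mpoly K[n]}) (c : 'I_r -> 'I_t -> {mpoly K[n]}).
Hypothesis f_comb : forall k, f k = \sum_j c k j * g j.
Hypothesis g_order : forall j l, (g j)@_l != 0 -> (d <= mdeg l)%N.
Local Notation B := {mpoly {mpoly K[n]}[t]}.
Implicit Types zeta : B.

Definition tdeg_le e eta := forall m, eta@_m != 0 -> (mdeg m <= e)%N.

Lemma tdeg_le_fil e eta : tdeg_le e eta -> fil d (- (d * e)%N%:Z) eta.
Proof.
move=> te m l H; have/te : eta@_m != 0.
  by apply: contraNneq H => ->; rewrite mcoeff0.
by nia.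
Qed.

Lemma tdeg_leM_linear e eta (a : 'I_r -> {mpoly K[n]}) :
  tdeg_le e eta -> tdeg_le e.+1 (eta * \sum_k a k *: 'X_k).
Proof.
move=> te m; rewrite mulr_sumr raddf_sum => /sum_neq0P[k _].
rewrite /= -scalerAr mcoeffZ mulf_eq0 negb_or mcoeffM => /andP[_].
case/sum_neq0P => -[m1 m2] /= /eqP mE.
rewrite mulf_eq0 negb_or => /andP[/te H1]; rewrite mcoeffX.
case: (eqVneq U_(k)%MM (m2 : 'X_{1..r})) => [m2E _|_]; last by rewrite eqxx.
by have := congr1 mdeg mE; rewrite mdegD -m2E mdeg1; move: H1; lia.
Qed.

(* The bound on the degree of eta in d/dt, rather than on its weight, is what
   makes the condition stable under [cderiv]. *)
Definition vanish zeta := forall js eta, tdeg_le (size js) eta ->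
  lam (eta * subst c (opts g js zeta)) = 0.

Lemma vanishD x y : vanish x -> vanish y -> vanish (x + y).
Proof.
by move=> vx vy js eta fe; rewrite optsD substD mulrDr lamD vx // vy // addr0.
Qed.

Lemma vanish0 : vanish 0.
Proof.
move=> js eta _; have -> : opts g js 0 = 0.
  by elim: js => //= j js ->; rewrite /opt scaler0 mderiv0 addr0.
by rewrite subst0 mulr0 lam0.
Qed.

Lemma vanishZ h x : vanish x -> vanish (h *: x).
Proof.
move=> vx js eta fe; rewrite optsZ substZ -scalerAr scalerAl.
apply: vx => m; rewrite mcoeffZ mulf_eq0 negb_or => /andP[_]; exact: fe.
Qed.

(** Both terms of [opt] raise the weight: [g j] has order at least [d], and [mderiv] removes a
    variable of weight - d. *)
Lemma fil_opt e j zeta : fil d e zeta -> fil d (e + d%:Z) (opt g j zeta).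
Proof.
move=> fz; apply: filD; last exact: fil_mderiv.
rewrite -mul_mpolyC addrC; apply: filM => //.
by apply: filC => l /g_order; rewrite lez_nat.
Qed.

Lemma fil_opts e js zeta :
  fil d e zeta -> fil d (e + (d * size js)%N%:Z) (opts g js zeta).
Proof.
move=> fz; elim: js => [|j js IH] /=; first by rewrite muln0 addr0.
have -> : e + (d * (size js).+1)%N%:Z = e + (d * size js)%N%:Z + d%:Z by lia.
exact: fil_opt.
Qed.

(** The operator t^J raises the weight by d |J|, while [eta] lowers it by at most that much; the
    result still has weight at least 1. *)
Lemma fil1_vanish zeta : fil d 1 zeta -> vanish zeta.
Proof.
move=> fz js eta fe; apply: lam_fil1.
have -> : (1 : int) = - (d * size js)%N%:Z + (1 + (d * size js)%N%:Z) by lia.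
by apply: filM; [exact: tdeg_le_fil | apply: fil_subst; apply: fil_opts].
Qed.

Lemma vanish_s j x : vanish x -> vanish ('X_j * opt g j x).
Proof.
move=> vx js eta fe; rewrite opts_mulX_opt substD mulrDr lamD substM substX.
(* The factor [sublin j] raises the degree of [eta] by one, as permitted by the longer list
   [j :: js]. *)
rewrite mulrA vx ?add0r; last exact: tdeg_leM_linear.
by rewrite substZ -scalerAr lam_nat vx // mulr0.
Qed.

Lemma vanish_d i x : vanish x -> vanish (opd g i x).
Proof.
move=> vx js eta fe; rewrite opts_opd (subst_opd f_comb) mulrBr.
set z := subst c (opts g js x).
(* By the Leibniz rule [eta] moves under d_i. Then [lam] kills the first term, and [cderiv i eta]
   obeys the same degree bound as [eta]. *)
have opdE : eta * opd f i z = opd f i (eta * z) - cderiv i eta * z.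
  have ringE (S : comNzRingType) (a b ca cb u : S) :
    a * (cb + u * b) = (ca * b + a * cb) + u * (a * b) - ca * b by ring.
  by rewrite /opd cderivM; exact: ringE.
rewrite opdE !lam_additive lam_opd sub0r vx ?oppr0; last first.
  move=> m; rewrite mcoeff_cderiv => H; apply: fe.
  by apply: contraNneq H => ->; rewrite mderiv0.
(* Each correction term of [subst_opd] brings one more linear form in d/dt and one more t_j, so that
   [vx] applies to [j :: js]. *)
rewrite sub0r mulr_sumr lam_sum big1 ?oppr0 // => j _.
rewrite mulrA; apply: (vx (j :: js)).
rewrite /sublin cderiv_sum; under eq_bigr do rewrite cderivZX.
exact: tdeg_leM_linear.
Qed.

(** The element b(s_1 + ... + s_t) delta(t - g), since 1 stands for delta(t - g). *)
Definition bs_poly (b : {poly K}) : B :=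
  \sum_(i < size b) (b`_i)%:MP *: iter i (ops g) 1.

(** Take the empty list and [eta = 1]: after substitution [lam] kills b(s) delta(t - f), and by
    [lam_ops] its value there is b(- n/d) times [lam 1]. *)
Lemma vanish_root b : d%:R != 0 :> K -> P 0%MM != 0 ->
  vanish (bs_poly b) -> root b (- (n%:R / d%:R)).
Proof.
move=> d0 P0 /(_ [::] 1) H.
have {}H : lam (subst c (bs_poly b)) = 0.
  rewrite -[subst _ _]mul1r; apply: H => m; rewrite mcoeff1.
  by case: (eqVneq m 0%MM) => [->|_]; rewrite ?mdeg0 // eqxx.
have iterE i : subst c (iter i (ops g) 1) = iter i (ops f) 1.
  elim: i => [|i IH] /=; first by rewrite -mpolyC1 substC.
  by rewrite (subst_ops f_comb) IH.
have lam_iter i : lam (iter i (ops f) 1) = (- (n%:R / d%:R)) ^+ i * lam 1.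
  elim: i => [|i IH]; first by rewrite mul1r.
  rewrite iterS exprS -mulrA -IH; apply: (mulIf d0).
  rewrite mulr_natr lam_ops !mulNr; congr (- _).
  by rewrite mulrAC divfK // mulr_natl.
(* [P 0] is homogeneous of degree 0, hence a nonzero constant, and [lam 1] is its constant term. *)
have lam1 : lam 1 != 0.
  have := lamZX 1 0%MM; rewrite mpolyX0 scale1r mdeg0 mul1r => ->.
  have := mpairZXl 1 0%MM (P 0%MM).
  rewrite mpolyX0 scale1r mul1r big1 => [->|i _]; last by rewrite mnm0E.
  apply: contraNneq P0 => P00; apply/eqP/mpolyP => l; rewrite mcoeff0.
  have [->//|l0] := eqVneq l 0%MM.
  apply: (dhomog_nemf_coeff (P_hom 0%MM)).
  by rewrite /= mdeg0 muln0 mdeg_eq0.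
have : b.[- (n%:R / d%:R)] * lam 1 = 0.
  rewrite -H /bs_poly subst_sum lam_sum horner_coef mulr_suml.
  by apply: eq_bigr => i _; rewrite substZ lamZ iterE lam_iter mulrA.
by move/eqP; rewrite mulf_eq0 (negPf lam1) orbF.
Qed.

End Vanishing.
End Functional.

(** * Comparison with the module of the functional equation *)

Section FractionDerivation.
Variables (K : fieldType) (n : nat).
Local Notation ratfun := {fraction {mpoly K[n]}}.
Implicit Types (a b : ratfun) (p q : {mpoly K[n]}).

Lemma polyF_neq0 p : p != 0 -> polyF p != 0.
Proof. by rewrite /polyF tofrac_eq0. Qed.

Lemma polyFD p q : polyF (p + q) = polyF p + polyF q.
Proof. exact: tofracD. Qed.

Lemma polyFB p q : polyF (p - q) = polyF p - polyF q.
Proof. exact: tofracB. Qed.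

Lemma polyFM p q : polyF (p * q) = polyF p * polyF q.
Proof. exact: tofracM. Qed.

Lemma polyFX p k : polyF (p ^+ k) = polyF p ^+ k.
Proof. exact: tofracXn. Qed.

Lemma polyF1 : polyF 1 = 1 :> ratfun.
Proof. exact: tofrac1. Qed.

Lemma polyF0 : polyF 0 = 0 :> ratfun.
Proof. exact: tofrac0. Qed.

Lemma polyF_prod (I : Type) (s : seq I) (Q : pred I) (F : I -> {mpoly K[n]}) :
  polyF (\prod_(i <- s | Q i) F i) = \prod_(i <- s | Q i) polyF (F i).
Proof. exact: rmorph_prod. Qed.

Lemma polyF_natr k : polyF k%:R = k%:R :> ratfun.
Proof. exact: rmorph_nat. Qed.

Lemma fraction_split a : exists p q, q != 0 /\ a = polyF p / polyF q.
Proof.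
exists (frac (repr a)).1, (frac (repr a)).2.
have q0 : (frac (repr a)).2 != 0 by exact: denom_ratioP.
split=> //; rewrite /polyF -frac_repr mulfK //; exact: polyF_neq0.
Qed.

Lemma fderiv_polyF i p : fderiv i (polyF p) = polyF p^`M(i).
Proof.
have := fderivE i p (oner_neq0 {mpoly K[n]}).
rewrite -mpolyC1 mderivC mulr0 subr0 mpolyC1 mulr1 expr1n.
by rewrite /polyF tofrac1 !divr1.
Qed.

Lemma fderiv_div i p q : q != 0 -> fderiv i (polyF p / polyF q) =
  (polyF p^`M(i) * polyF q - polyF p * polyF q^`M(i)) / polyF q ^+ 2.
Proof.
by move=> q0; rewrite fderivE // polyFX polyFB (polyFM p^`M(i)) (polyFM p).
Qed.

Lemma polyF_mderivM i p q : polyF (p * q)^`M(i) =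
  polyF p^`M(i) * polyF q + polyF p * polyF q^`M(i).
Proof. by rewrite mderivM polyFD (polyFM p^`M(i)) (polyFM p). Qed.

Lemma fderivD i a b : fderiv i (a + b) = fderiv i a + fderiv i b.
Proof.
have [p [q [q0 ->]]] := fraction_split a; have [u [v [v0 ->]]] := fraction_split b.
have Q0 := polyF_neq0 q0; have V0 := polyF_neq0 v0.
have -> : polyF p / polyF q + polyF u / polyF v =
    polyF (p * v + u * q) / polyF (q * v).
  rewrite (polyFD (p * v)) (polyFM p) (polyFM u) (polyFM q).
  exact: (addf_div _ _ Q0 V0).
rewrite (fderiv_div i p q0) (fderiv_div i u v0) (fderiv_div i _ (mulf_neq0 q0 v0)).
rewrite mderivD (polyFD (p * v)^`M(i)) (polyFD (p * v)).
rewrite (polyF_mderivM i p v) (polyF_mderivM i u q) (polyF_mderivM i q v).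
rewrite (polyFM p v) (polyFM u q) (polyFM q v).
have fieldE (F : fieldType) (P P' U U' Q Q' V V' : F) : Q != 0 -> V != 0 ->
  ((P' * V + P * V' + (U' * Q + U * Q')) * (Q * V) -
   (P * V + U * Q) * (Q' * V + Q * V')) / (Q * V) ^+ 2 =
  (P' * Q - P * Q') / Q ^+ 2 + (U' * V - U * V') / V ^+ 2.
  by move=> ? ?; field; apply/andP.
exact: (fieldE _ _ _ _ _ _ _ _ _ Q0 V0).
Qed.

Lemma fderivM i a b : fderiv i (a * b) = fderiv i a * b + a * fderiv i b.
Proof.
have [p [q [q0 ->]]] := fraction_split a; have [u [v [v0 ->]]] := fraction_split b.
have Q0 := polyF_neq0 q0; have V0 := polyF_neq0 v0.
have -> : (polyF p / polyF q) * (polyF u / polyF v) =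
    polyF (p * u) / polyF (q * v).
  by rewrite (polyFM p) (polyFM q); exact: mulf_div.
rewrite (fderiv_div i p q0) (fderiv_div i u v0) (fderiv_div i _ (mulf_neq0 q0 v0)).
rewrite (polyF_mderivM i p u) (polyF_mderivM i q v) (polyFM p u) (polyFM q v).
have fieldE (F : fieldType) (P P' U U' Q Q' V V' : F) : Q != 0 -> V != 0 ->
  ((P' * U + P * U') * (Q * V) - P * U * (Q' * V + Q * V')) / (Q * V) ^+ 2 =
  (P' * Q - P * Q') / Q ^+ 2 * (U / V) + P / Q * ((U' * V - U * V') / V ^+ 2).
  by move=> ? ?; field; apply/andP.
exact: (fieldE _ _ _ _ _ _ _ _ _ Q0 V0).
Qed.

Lemma fderiv_additive i : zmod_morphism (@fderiv K n i).
Proof.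
by move=> a b; apply: (addIr (fderiv i b)); rewrite -fderivD !subrK.
Qed.

HB.instance Definition _ i :=
  GRing.isZmodMorphism.Build ratfun ratfun (@fderiv K n i) (fderiv_additive i).

Lemma fderiv_nat i k : fderiv i (k%:R : ratfun) = 0.
Proof.
by rewrite -polyF_natr fderiv_polyF -mpolyC_nat mderivC polyF0.
Qed.

Lemma fderiv_logM i a b : a != 0 -> b != 0 ->
  fderiv i (a * b) / (a * b) = fderiv i a / a + fderiv i b / b.
Proof.
have fieldE (F : fieldType) (x x' y y' : F) : x != 0 -> y != 0 ->
    (x' * y + x * y') / (x * y) = x' / x + y' / y.
  by move=> ? ?; field; apply/andP.
by move=> a0 b0; rewrite fderivM; exact: (fieldE _ _ _ _ _ a0 b0).
Qed.

Lemma fderiv_logX i a k :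
  a != 0 -> fderiv i (a ^+ k) / a ^+ k = (fderiv i a / a) *+ k.
Proof.
move=> a0; elim: k => [|k IH].
  by rewrite expr0 -[1]/(1%:R) fderiv_nat mul0r.
by rewrite exprS (fderiv_logM i a0 (expf_neq0 k a0)) IH mulrS.
Qed.

Lemma fderiv_log_prod i (k : nat) (F : 'I_k -> ratfun) (e : 'I_k -> nat) :
  (forall j, F j != 0) ->
  fderiv i (\prod_j F j ^+ e j) / \prod_j F j ^+ e j =
  \sum_j (fderiv i (F j) / F j) *+ e j.
Proof.
move=> F0.
(* The induction also carries the nonvanishing of the partial products, which [fderiv_logM]
   requires. *)
suff [] : \prod_j F j ^+ e j != 0 /\
  fderiv i (\prod_j F j ^+ e j) / \prod_j F j ^+ e j =
  \sum_j (fderiv i (F j) / F j) *+ e j by [].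
apply: (big_ind2 (fun x y => x != 0 /\ fderiv i x / x = y)).
- by rewrite oner_neq0 -[1]/(1%:R) fderiv_nat mul0r.
- move=> x x' y y' [x0 <-] [y0 <-]; split; first exact: (mulf_neq0 x0 y0).
  exact: (fderiv_logM i x0 y0).
- by move=> j _; split; [exact: (expf_neq0 _ (F0 j)) | exact: (fderiv_logX i _ (F0 j))].
Qed.

End FractionDerivation.

(** * The map from B_g to the module of g^s *)

Section Representation.
Variables (K : fieldType) (n r : nat) (g : 'I_r -> {mpoly K[n]}).
Hypothesis g_neq0 : forall k, g k != 0.
Local Notation ratfun := {fraction {mpoly K[n]}}.
Local Notation bsmod := {mpoly ratfun[r]}.
Local Notation A := {mpoly {mpoly K[n]}[r]}.
Implicit Types (xi : A) (m : 'X_{1..r}).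

Definition sfall m : bsmod := \prod_(j < r) \prod_(l < m j) ('X_j - l%:R).

Definition gpow m : ratfun := \prod_j polyF (g j) ^+ m j.

Let polyg_neq0 j : polyF (g j) != 0. Proof. exact: polyF_neq0. Qed.

Lemma gpow_neq0 m : gpow m != 0.
Proof. by apply/prodf_neq0 => j _; exact: expf_neq0. Qed.

Lemma gpowD m j : gpow (m + U_(j)) = gpow m * polyF (g j).
Proof.
rewrite /gpow (bigD1 j) //= [in RHS](bigD1 j) //= mnmDE mnm1E eqxx addn1 exprSr.
rewrite mulrAC; congr (_ * _ * _); apply: eq_bigr => l lj.
by rewrite mnmDE mnm1E eq_sym (negPf lj) addn0.
Qed.

Lemma sfallD m j : sfall (m + U_(j)) = sfall m * ('X_j - (m j)%:R).
Proof.
rewrite /sfall (bigD1 j) //= [in RHS](bigD1 j) //= mnmDE mnm1E eqxx addn1.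
rewrite big_ord_recr /= mulrAC; congr (_ * _ * _); apply: eq_bigr => l lj.
by rewrite mnmDE mnm1E eq_sym (negPf lj) addn0.
Qed.

(* (- d/dt)^m delta(t - g) is g^{-m} times the falling factorial [s]_m. *)
Let rep_summand m (h : {mpoly K[n]}) : bsmod := (polyF h / gpow m) *: sfall m.

Definition rep : A -> bsmod := locked (mlin rep_summand).

Let rep_summand_additive m : zmod_morphism (rep_summand m).
Proof. by move=> x y; rewrite /rep_summand polyFB mulrBl scalerBl. Qed.

Lemma rep_additive : zmod_morphism rep.
Proof. by move=> x y; rewrite /rep -lock (mlin_additive rep_summand_additive). Qed.

Lemma repD x y : rep (x + y) = rep x + rep y.
Proof. exact: (zmod_morphismD rep_additive). Qed.

Lemma rep0 : rep 0 = 0.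
Proof. exact: (zmod_morphism0 rep_additive). Qed.

Lemma rep_sum (I : Type) (s : seq I) (F : I -> A) :
  rep (\sum_(i <- s) F i) = \sum_(i <- s) rep (F i).
Proof. exact: (zmod_morphism_sum rep_additive). Qed.

Lemma repZX h m : rep (h *: 'X_[m]) = (polyF h / gpow m) *: sfall m.
Proof. by rewrite /rep -lock (mlinZX rep_summand_additive). Qed.

Lemma repE xi :
  rep xi = \sum_(m <- msupp xi) (polyF xi@_m / gpow m) *: sfall m.
Proof. by rewrite /rep -lock. Qed.

Lemma repZ h xi : rep (h *: xi) = polyF h *: rep xi.
Proof.
elim/mpoly_monomial_ind: xi => [|x y ex ey|a m].
- by rewrite scaler0 rep0 scaler0.
- by rewrite scalerDr (repD (h *: x)) (repD x) ex ey scalerDr.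
by rewrite scalerA !repZX scalerA polyFM mulrA.
Qed.

(** One more ['X_j] adds the factor s_j - m_j to the falling factorial and g_j to the denominator.
    Here [a] will be g_j in [rep_s] and d_i g_j in [rep_d]. *)
Lemma rep_mulX j a h m : rep ((a * h) *: 'X_[m + U_(j)]) =
  (polyF a / polyF (g j) * (polyF h / gpow m)) *: (sfall m * ('X_j - (m j)%:R)).
Proof.
rewrite repZX gpowD sfallD (polyFM a); congr (_ *: _).
have fieldE (F : fieldType) (x y z u : F) : x != 0 -> z != 0 ->
  u * y / (z * x) = u / x * (y / z) by move=> ? ?; field; apply/andP.
exact: (fieldE _ _ _ _ _ (polyg_neq0 j) (gpow_neq0 m)).
Qed.

(** On a monomial, the [g j] part gives s_j - m_j and the [mderiv] part gives m_j. *)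
Lemma rep_s j xi : rep ('X_j * opt g j xi) = 'X_j * rep xi.
Proof.
elim/mpoly_monomial_ind: xi => [|x y ex ey|h m].
- by rewrite /opt scaler0 mderiv0 addr0 mulr0 rep0 mulr0.
- rewrite (optD g j x) (mulrDr 'X_j (opt g j x)) (repD ('X_j * opt g j x)).
  by rewrite [in RHS](repD x y) [RHS]mulrDr; exact: (congr2 +%R ex ey).
have -> : 'X_j * opt g j (h *: 'X_[m]) =
    (g j * h) *: 'X_[m + U_(j)] + (m j)%:R *: (h *: 'X_[m]).
  rewrite /opt mderivZ mulrDr -!scalerAr mulX_mderivX !scalerA.
  by rewrite -mpolyXD addmC [h * _]mulrC.
rewrite repD rep_mulX (divff (polyg_neq0 j)) mul1r repZ repZX polyF_natr.
have algE (F : comNzRingType) (a N : F) (e x : {mpoly F[r]}) :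
    a *: (e * (x - N%:MP)) + N *: (a *: e) = x * (a *: e).
  by rewrite -!mul_mpolyC; ring.
by rewrite -mpolyC_nat; exact: algE.
Qed.

(** The factors have integer coefficients, which the derivation kills. *)
Lemma sfall_const i m : map_mpoly (@fderiv K n i) (sfall m) = 0.
Proof.
pose D : {additive ratfun -> ratfun} := @fderiv K n i.
have D_leibniz : forall a b, D (a * b) = D a * b + a * D b by exact: fderivM.
have D_prod (I : Type) (s : seq I) (F : I -> bsmod) :
    (forall j, map_mpoly D (F j) = 0) -> map_mpoly D (\prod_(j <- s) F j) = 0.
  move=> F0; elim/big_rec: _ => [|j x _ x0].
    by rewrite -mpolyX0; exact: (map_derivX D_leibniz).
  by rewrite (map_derivM D_leibniz) F0 x0 mul0r mulr0 addr0.
apply: (D_prod) => j; apply: (D_prod) => l.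
have mapB x y : map_mpoly D (x - y : bsmod) = map_mpoly D x - map_mpoly D y.
  exact: raddfB.
rewrite mapB (map_derivX D_leibniz) -mpolyC_nat map_mpolyC [D _](fderiv_nat K i).
by rewrite mpolyC0 subr0.
Qed.

Lemma bs_deriv_additive i : zmod_morphism (bs_deriv g i).
Proof.
move=> x y; rewrite /bs_deriv mulrBl.
have -> : map_mpoly (@fderiv K n i) (x - y) =
    map_mpoly (@fderiv K n i) x - map_mpoly (@fderiv K n i) y by exact: raddfB.
by rewrite opprD addrACA.
Qed.

Lemma fderiv_div_gpow i h m : fderiv i (polyF h / gpow m) =
  polyF h^`M(i) / gpow m
  - polyF h / gpow m * \sum_j (polyF (g j)^`M(i) / polyF (g j)) *+ m j.
Proof.
have G0 := gpow_neq0 m.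
have LG : fderiv i (gpow m) / gpow m =
    \sum_j (polyF (g j)^`M(i) / polyF (g j)) *+ m j.
  rewrite /gpow (fderiv_log_prod i m polyg_neq0).
  by apply: eq_bigr => j _; rewrite fderiv_polyF.
have := fderivM i (polyF h / gpow m) (gpow m).
rewrite divfK // fderiv_polyF => ->; rewrite -LG.
have fieldE (F : fieldType) (x y z w : F) : z != 0 ->
    x = (x * z + y / z * w) / z - y / z * (w / z) by move=> ?; field.
exact: (fieldE _ _ _ _ _ G0).
Qed.

(** Differentiating g^{-m} gives - m_j d_i(g_j)/g_j and differentiating g^s gives s_j d_i(g_j)/g_j;
    the sum is the factor in [rep_mulX]. *)
Lemma rep_d i xi : rep (opd g i xi) = bs_deriv g i (rep xi).
Proof.
elim/mpoly_monomial_ind: xi => [|x y ex ey|h m].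
- rewrite rep0 (zmod_morphism0 (bs_deriv_additive i)).
  by rewrite /opd cderiv0 mulr0 addr0 rep0.
- rewrite (opdD g i x) (repD (opd g i x)) [in RHS](repD x y).
  rewrite [RHS](zmod_morphismD (bs_deriv_additive i)).
  exact: (congr2 +%R ex ey).
rewrite /opd cderivZX linear_formZX repD rep_sum !repZX.
rewrite /bs_deriv.
pose D : {additive ratfun -> ratfun} := @fderiv K n i.
have D_leibniz : forall a b, D (a * b) = D a * b + a * D b by exact: fderivM.
have -> : map_mpoly (@fderiv K n i) ((polyF h / gpow m) *: sfall m) =
    fderiv i (polyF h / gpow m) *: sfall m.
  rewrite -!mul_mpolyC (map_derivM D_leibniz) (map_mpolyC _ D).
  by rewrite sfall_const mulr0 addr0.
rewrite fderiv_div_gpow scalerBl -addrA; congr (_ + _).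
rewrite -(scalerA (polyF h / gpow m)) scaler_suml scaler_sumr -sumrN mulr_sumr -big_split.
apply: eq_bigr => j _ /=.
rewrite rep_mulX -mpolyC_nat -(mulr_natl (polyF (g j)^`M(i) / _) (m j)).
have algE (F : comNzRingType) (H a N : F) (e x : {mpoly F[r]}) :
    (a * H) *: (e * (x - N%:MP)) = - (H *: ((N * a) *: e)) + (H *: e) * (a *: x).
  by rewrite -!mul_mpolyC !mpolyCM; ring.
exact: algE.
Qed.

End Representation.

(** * Injectivity, generators and the functional equation *)

Section Relation.
Variables (K : fieldType) (n r : nat) (g : 'I_r -> {mpoly K[n]}).
Hypothesis g_neq0 : forall k, g k != 0.
Local Notation ratfun := {fraction {mpoly K[n]}}.
Local Notation bsmod := {mpoly ratfun[r]}.
Local Notation A := {mpoly {mpoly K[n]}[r]}.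
Implicit Types (xi : A) (m : 'X_{1..r}).

Lemma ratfun_natr_neq0 k : [pchar K] =i pred0 -> k.+1%:R != 0 :> ratfun.
Proof.
move=> /pcharf0P char0; rewrite -polyF_natr; apply: polyF_neq0.
by rewrite -mpolyC_nat mpolyC_eq0 char0.
Qed.

Lemma meval_sfall m (v : 'I_r -> ratfun) :
  (sfall K n m).@[v] = \prod_j \prod_(l < m j) (v j - l%:R).
Proof.
rewrite /sfall rmorph_prod; apply: eq_bigr => j _.
rewrite rmorph_prod; apply: eq_bigr => l _.
by rewrite /= mevalB mevalXU -mpolyC_nat mevalC.
Qed.

(* Evaluating s at the smallest exponent m of xi kills all terms but that of m,
   as [s]_m' vanishes at m unless m' <= m. *)
Lemma rep_eq0 xi : [pchar K] =i pred0 -> rep g xi = 0 -> xi = 0.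
Proof.
move=> char0 rep0; apply/eqP; apply: contraT => xi0.
pose m := mlast xi; have m_supp : m \in msupp xi by exact: mlast_supp.
pose v j : ratfun := (m j)%:R.
have diag_neq0 : (sfall K n m).@[v] != 0.
  rewrite meval_sfall; apply/prodf_neq0 => j _; apply/prodf_neq0 => l _.
  (* The factors [m j - l] with [l < m j] are positive integers, nonzero in characteristic 0. *)
  rewrite /v -natrB ?(ltnW (ltn_ord l)) //.
  have : (0 < m j - l)%N by rewrite subn_gt0.
  by case: (m j - l)%N => // k _; exact: ratfun_natr_neq0.
have offdiag m' : m' \in msupp xi -> m' != m -> (sfall K n m').@[v] = 0.
  move=> m'_supp m'm.
  have /existsP[j mj] : [exists j, (m j < m' j)%N].
    apply: contraNT m'm => /existsPn m'_le.
    have le_m'm : (m' <= m)%MM by apply/mnm_lepP => j; rewrite leqNgt m'_le.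
    (* The monomial order refines the degree, so the smallest exponent [m] has degree at most that
       of [m']; together with [m' <= m] this forces equality. *)
    have := lemc_mdeg (mlast_lemc m'_supp); rewrite -/m -{1}(submK le_m'm).
    rewrite mdegD -{2}[mdeg m']add0n leq_add2r leqn0 mdeg_eq0 => /eqP mm'0.
    by rewrite -(submK le_m'm) mm'0 add0m.
  rewrite meval_sfall (bigD1 j) //= (bigD1 (Ordinal mj)) //=.
  by rewrite /v subrr !mul0r.
have : (rep g xi).@[v] = 0 by rewrite rep0 meval0.
rewrite repE raddf_sum (bigD1_seq m) ?msupp_uniq //= big_seq_cond big1 => [|m'].
  rewrite addr0 mevalZ => /eqP; rewrite !mulf_eq0 invr_eq0.
  rewrite (negPf diag_neq0) (negPf (gpow_neq0 g_neq0 m)) !orbF.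
  by rewrite (negPf (polyF_neq0 _)) // -mcoeff_msupp.
by case/andP=> m'_supp m'm; rewrite mevalZ offdiag ?mulr0.
Qed.

Lemma rep_ops xi : rep g (ops g xi) = (\sum_j 'X_j) * rep g xi.
Proof.
rewrite /ops rep_sum mulr_suml; apply: eq_bigr => j _.
exact: rep_s.
Qed.

Lemma rep1 : rep g 1 = 1.
Proof.
rewrite -mpolyX0 -['X_[0]]scale1r repZX polyF1.
have -> : gpow g 0 = 1 by rewrite /gpow big1 // => j _; rewrite mnm0E.
have -> : sfall K n (0%MM : 'X_{1..r}) = 1.
  by apply: big1 => j _; apply: big1 => -[l]; rewrite mnm0E.
by rewrite divr1 scale1r.
Qed.

Lemma rep_bs_poly (b : {poly K}) :
  rep g (bs_poly g b) = (map_poly (@bs_const K n r) b).[\sum_(k < r) 'X_k].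
Proof.
rewrite /map_poly horner_poly /bs_poly rep_sum; apply: eq_bigr => i _.
rewrite repZ.
have -> : rep g (iter i (ops g) 1) = (\sum_j 'X_j) ^+ i.
  by elim: (i : nat) => [|k IH]; rewrite ?rep1 // iterS rep_ops IH exprS.
by rewrite /bs_const mul_mpolyC.
Qed.


Definition order_ge e (p : {mpoly K[n]}) :=
  forall l, p@_l != 0 -> (e <= mdeg l)%N.

Lemma order_ge0 p : order_ge 0 p. Proof. by []. Qed.

Lemma order_geM e e' p q :
  order_ge e p -> order_ge e' q -> order_ge (e + e') (p * q).
Proof.
move=> hp hq l; rewrite mcoeffM => /sum_neq0P[[l1 l2] /= /eqP lE].
rewrite mulf_eq0 negb_or => /andP[/hp H1 /hq H2].
by rewrite (congr1 mdeg lE) mdegD leq_add.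
Qed.

Lemma order_ge_expr e k p : order_ge e p -> order_ge (e * k) (p ^+ k).
Proof.
move=> hp; elim: k => [|k IH]; first by rewrite muln0; exact: order_ge0.
by rewrite mulnS exprS; exact: order_geM.
Qed.

Lemma order_ge_prod e (F : 'I_r -> {mpoly K[n]}) (k : 'I_r -> nat) :
  (forall j, order_ge e (F j)) -> order_ge (e * \sum_j k j) (\prod_j F j ^+ k j).
Proof.
move=> hF; apply: (big_ind2 (fun a p => order_ge (e * a) p)).
- by rewrite muln0; exact: order_ge0.
- by move=> a p b q hp hq; rewrite mulnDr; exact: order_geM.
- by move=> j _; exact: order_ge_expr.
Qed.

(** The negative part of [u] becomes an exponent of - d/dt, binomials being falling factorials over
    factorials; the positive part becomes a product of powers of the [g k]. *)
Lemma bs_gen_rep d (u : {ffun 'I_r -> int}) : (0 < d)%N ->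
    (forall j, order_ge d (g j)) -> \sum_k u k = 1 ->
  exists2 xi, fil d 1 xi & bs_gen g u = rep g xi.
Proof.
move=> d_gt0 g_order u1.
pose neg k := if u k < 0 then `|u k|%N else 0%N.
pose pos k := if u k < 0 then 0%N else `|u k|%N.
have u_split k : u k = (pos k)%:Z - (neg k)%:Z.
  by rewrite /pos /neg; case: ltP; lia.
pose m := [multinom neg k | k < r].
have mE k : m k = neg k by rewrite /m mnmE.
have mdegm : mdeg m = (\sum_k neg k)%N.
  by rewrite mdegE; apply: eq_bigr => k _; exact: mE.
pose c : K := \prod_(k < r) ((neg k)`!%:R)^-1.
exists ((c%:MP * \prod_k g k ^+ pos k) *: 'X_[m]).
  apply: filZX => l; rewrite mul_mpolyC mcoeffZ mulf_eq0 negb_or => /andP[_].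
  move/(order_ge_prod g_order); rewrite mdegm.
  have : (\sum_k pos k)%N%:Z - (\sum_k neg k)%N%:Z = 1.
    rewrite -u1 (eq_bigr _ (fun k _ => u_split k)) sumrB.
    by rewrite !(big_morph Posz PoszD (erefl 0%:Z)).
  move: d_gt0 (\sum_k pos k)%N (\sum_k neg k)%N => {}d_gt0 a b ab.
  (* As the [u k] add up to 1, the product has order at least d (b + 1), which exceeds d b because
     [d] is positive. *)
  have -> : a = b.+1 by lia.
  by rewrite mulnS; lia.
rewrite repZX /bs_gen polyFM polyF_prod.
have -> : \prod_(k < r) polyF (g k) ^ u k =
    (\prod_k polyF (g k ^+ pos k)) / gpow g m.
  rewrite /gpow -prodfV -big_split; apply: eq_bigr => k _ /=.
  rewrite u_split expfzDr ?polyF_neq0 // polyFX mE.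
  by rewrite -exprnN.
have -> : \prod_(k < r | u k < 0) sbinom K n k `|u k|%N =
    (polyF c%:MP) *: sfall K n m.
  rewrite big_mkcond /sfall /c.
  have -> : polyF (\prod_(k < r) ((neg k)`!%:R)^-1)%:MP =
      \prod_(k < r) ((neg k)`!%:R)^-1 :> ratfun.
    rewrite rmorph_prod polyF_prod; apply: eq_bigr => k _.
    rewrite -[LHS]/((@FracField.tofrac {mpoly K[n]} \o @mpolyC n K) _).
    by rewrite fmorphV rmorph_nat.
  rewrite -scaler_prod; apply: eq_bigr => k _; rewrite mE /sbinom /neg.
  by case: ifP => // _; rewrite fact0 invr1 scale1r big_ord0.
by rewrite scalerA; congr (_ *: _); rewrite mulrC mulrA.
Qed.

Section Weyl.
Variables (s : nat) (f : 'I_s -> {mpoly K[n]}) (P : 'X_{1..s} -> {mpoly K[n]}).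
Variables (d : nat) (c : 'I_s -> 'I_r -> {mpoly K[n]}).
Hypothesis P_rec : forall (i : 'I_n) (m : 'X_{1..s}),
  'X_i * P m = \sum_(k < s) diffop (f k)^`M(i) (P (m + U_(k))%MM).
Hypothesis f_comb : forall k, f k = \sum_j c k j * g j.

(** Induction on the operator: each generator of D_x[s] lifts through [rep] to an operator that
    preserves [vanish]. *)
Lemma weyl_op_rep Q xi : weyl_op g Q -> vanish P g c xi ->
  exists2 xi', vanish P g c xi' & Q (rep g xi) = rep g xi'.
Proof.
move=> QW; elim: QW xi => {Q} [p|k|i|Q1 Q2 _ IH1 _ IH2|Q1 Q2 _ IH1 _ IH2] xi xiV.
- by exists (p *: xi); [exact: vanishZ | rewrite repZ].
- by exists ('X_k * opt g k xi); [exact: vanish_s | rewrite rep_s].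
- by exists (opd g i xi); [exact: (vanish_d P_rec f_comb) | rewrite rep_d].
- have [x1 V1 ->] := IH1 _ xiV; have [x2 V2 ->] := IH2 _ xiV.
  by exists (x1 + x2); [exact: vanishD | rewrite repD].
- have [x2 V2 ->] := IH2 _ xiV; exact: IH1.
Qed.


Hypothesis char0 : [pchar K] =i pred0.
Hypothesis d_gt0 : (0 < d)%N.
Hypothesis f_hom : forall k, f k \is d.-homog.
Hypothesis P_hom : forall m : 'X_{1..s}, P m \is (d * mdeg m).-homog.
Hypothesis P0_neq0 : P 0%MM != 0.
Hypothesis g_order : forall j, order_ge d (g j).

Lemma bs_relation_root (b : {poly K}) :
  bs_relation g b -> root b (- (n%:R / d%:R)).
Proof.
case=> us [Q [us1 usQ bE]].
have d_neq0 : d%:R != 0 :> K by have /pcharf0P -> := char0; rewrite -lt0n.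
apply: (vanish_root f_hom P_hom P_rec f_comb d_neq0 P0_neq0).
suff [xi xiV xiE] : exists2 xi, vanish P g c xi &
    \sum_(u <- us) Q u (bs_gen g u) = rep g xi.
  (* Injectivity of [rep] lifts the functional equation to [bs_poly g b = xi]. *)
  have /(rep_eq0 char0)/eqP : rep g (bs_poly g b - xi) = 0.
    by rewrite rep_additive rep_bs_poly bE xiE subrr.
  by rewrite subr_eq0 => /eqP ->.
elim: us us1 usQ {bE} => [|u us IH] us1 usQ.
  by exists 0; [exact: vanish0 | rewrite big_nil rep0].
have [||x xV xE] := IH.
- by move=> v vus; apply: us1; rewrite inE vus orbT.
- by move=> v vus; apply: usQ; rewrite inE vus orbT.
have [z zF zE] := bs_gen_rep d_gt0 g_order (us1 u (mem_head u us)).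
have zV : vanish P g c z by exact: (fil1_vanish P_hom c g_order zF).
have [y yV yE] := weyl_op_rep (usQ u (mem_head u us)) zV.
exists (y + x); first exact: vanishD.
by rewrite big_cons xE zE yE repD.
Qed.

End Weyl.
End Relation.

Theorem theoremA (R : realType) (n r d : nat) (hn : (0 < n)%N)
    (f : 'I_r -> {mpoly R[i][n]})
    (hf : forall k : 'I_r, f k \is d.-homog)
    (P : 'X_{1..r} -> {mpoly R[i][n]})
    (hP : forall alpha : 'X_{1..r}, P alpha \is (d * mdeg alpha).-homog)
    (hP0 : P 0%MM != 0)
    (hrec : forall (i : 'I_n) (alpha : 'X_{1..r}),
        'X_i * P alpha =
          \sum_(k < r) diffop (f k)^`M(i) (P (alpha + U_(k))%MM))
    (b : {poly R[i]}) (hb : bernstein_sato (ideal_gen f) b) :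
  root b (- (n%:R / d%:R)).
Proof.
have char0 : [pchar R[i]] =i pred0 by exact: pchar_num.
(* If [d] were 0, the derivatives of the [f k] would vanish and the recursion would give x_i P_0 = 0
   for an index i provided by [hn]. *)
have d_gt0 : (0 < d)%N.
  rewrite lt0n; apply: contra_neqN hP0 => /eqP d0; move: hf; rewrite d0 => hf0.
  have := hrec (Ordinal hn) 0%MM; rewrite big1 => [/eqP|k _].
    rewrite mulf_eq0 => /orP[/eqP X0|/eqP //].
    have := mcoeffXU R[i] (Ordinal hn) (Ordinal hn).
    by rewrite X0 mcoeff0 eqxx => /esym/eqP; rewrite oner_eq0.
  by rewrite dhomog0_mderiv // diffop0l.
have f_order k : order_ge d (f k).
  move=> l fl; rewrite leq_eqVlt; apply/orP; left; rewrite eq_sym.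
  by apply: contraNT fl => ld; apply/eqP/(dhomog_nemf_coeff (hf k)).
have [_ [t [g [g_neq0 gI [_ gb _]]]]] := hb.
have /fin_all_exists[c f_comb] :
    forall k, exists a : 'I_t -> {mpoly R[i][n]}, f k = \sum_j a j * g j.
  move=> k; apply/gI; exists (fun l => (l == k)%:R).
  rewrite (bigD1 k) //= eqxx mul1r big1 ?addr0 // => l /negPf ->.
  by rewrite mul0r.
(* The [g j] may be inhomogeneous, but as combinations of the [f k] they have order at least [d]. *)
have g_order j : order_ge d (g j).
  have /gI[a ->] : ideal_gen g (g j).
    exists (fun l => (l == j)%:R).
    rewrite (bigD1 j) //= eqxx mul1r big1 ?addr0 // => l /negPf ->.
    by rewrite mul0r.
  move=> l; rewrite raddf_sum => /sum_neq0P[k _].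
  exact: (order_geM (@order_ge0 _ _ (a k)) (@f_order k)).
exact: (bs_relation_root g_neq0 hrec f_comb char0 d_gt0 hf hP hP0 g_order gb).
Qed.
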